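(* Let $k\ge1$, let $\alpha_1,\dots,\alpha_k>-1$ and $\alpha_{k+1}>0$ be real, and put $\beta_j=\alpha_{j+1}+\alpha_{j+2}+\dots+\alpha_k+(k-j)+\alpha_{k+1}$ for $j=1,\dots,k$ (so $\beta_k=\alpha_{k+1}$). Let $(x_1,\dots,x_k)$ have the type-1 Dirichlet density $$f_1(x_1,\dots,x_k)=C\,x_1^{\alpha_1}\cdots x_k^{\alpha_k}(1-x_1-\dots-x_k)^{\alpha_{k+1}-1}$$ on $\{0<x_j<1,\ j=1,\dots,k,\ 0<x_1+\dots+x_k<1\}$ and $0$ elsewhere, where $C=\dfrac{\Gamma(\alpha_1+\dots+\alpha_{k+1}+k)}{\{\prod_{j=1}^k\Gamma(\alpha_j+1)\}\Gamma(\alpha_{k+1})}$. Let $(v_1,\dots,v_k)$ be a vector of positive real random variables with an arbitrary joint density $f(v_1,\dots,v_k)$ on $(0,\infty)^k$, independent of $(x_1,\dots,x_k)$. Let $$u_j=v_j\,\frac{x_j}{1-x_1-\dots-x_{j-1}},\quad j=1,\dots,k$$ (for $j=1$ the denominator is $1$), and let $g(u_1,\dots,u_k)$ be the joint density of $(u_1,\dots,u_k)$. Then, for (almost every) $(u_1,\dots,u_k)\in(0,\infty)^k$, $$\Big\{\prod_{j=1}^k\frac{\Gamma(\alpha_j+1)}{\Gamma(\alpha_j+\beta_j+1)}\Big\}g(u_1,\dots,u_k)=K_{u_j,j=1,\dots,k}^{(\alpha_j,\beta_j),j=1,\dots,k}f(u_1,\dots,u_k).$$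
   Context: The multivariable Kober fractional integral operator of the second kind is defined, for parameters $\zeta_j$ and $\alpha_j$ with $\alpha_j>0$, by $$K_{u_j,j=1,\dots,k}^{(\zeta_j,\alpha_j),j=1,\dots,k}f(u_1,\dots,u_k)=\Big\{\prod_{j=1}^k\frac{u_j^{\zeta_j}}{\Gamma(\alpha_j)}\Big\}\int_{v_1>u_1}\cdots\int_{v_k>u_k}\Big\{\prod_{j=1}^k(v_j-u_j)^{\alpha_j-1}v_j^{-\zeta_j-\alpha_j}\Big\}f(v_1,\dots,v_k)\,dv_1\cdots dv_k;$$ here it is applied with $\zeta_j=\alpha_j$ and $\alpha_j$ replaced by $\beta_j$. *)

(* Defs.v *)
From HB Require Import structures.
From mathcomp Require Import all_boot all_order all_algebra.
From mathcomp Require Import all_classical all_reals all_analysis.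
Set Implicit Arguments. Unset Strict Implicit. Unset Printing Implicit Defensive.
Import Order.TTheory GRing.Theory Num.Theory.
Import numFieldNormedType.Exports.
Local Open Scope classical_set_scope.
Local Open Scope ring_scope.

Definition Gamma (R : realType) (s : R) : R :=
  fine (\int[@lebesgue_measure R]_(t in `]0%R, +oo[) ((t `^ (s - 1)) * expR (- t))%:E)%E.

(* Integral w.r.t. the k-dimensional Lebesgue measure on n.-tuple R (= R^n),
   of a nonnegative function, written as the iterated one-dimensional Lebesgue
   integrals (Tonelli). *)
Fixpoint lebint (R : realType) (n : nat) : (n.-tuple R -> \bar R) -> \bar R :=
  match n return (n.-tuple R -> \bar R) -> \bar R with
  | 0 => fun F => F [tuple]
  | n'.+1 => fun F =>
      (\int[@lebesgue_measure R]_x lebint (fun t : n'.-tuple R => F (cons_tuple x t)))%E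
  end.

Definition positive_orthant (R : realType) (k : nat) : set (k.-tuple R) :=
  [set t | forall i : 'I_k, 0 < tnth t i].

Definition psum (R : realType) (k : nat) (x : k.-tuple R) (j : nat) : R :=
  \sum_(i < k | (i < j)%N) tnth x i.

(* The type-1 Dirichlet density with parameters alpha_1..alpha_k (alpha)
   and alpha_{k+1} (a). *)
Definition dirichlet1_const (R : realType) (k : nat) (alpha : 'I_k -> R) (a : R) : R :=
  Gamma (\sum_(i < k) alpha i + a + k%:R) /
  ((\prod_(i < k) Gamma (alpha i + 1)) * Gamma a).

Definition dirichlet1_density (R : realType) (k : nat) (alpha : 'I_k -> R) (a : R)
  (x : k.-tuple R) : R :=
  if `[< (forall i : 'I_k, 0 < tnth x i < 1) /\ 0 < psum x k < 1 >] then
    dirichlet1_const alpha a * (\prod_(i < k) (tnth x i) `^ (alpha i))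
      * (1 - psum x k) `^ (a - 1)
  else 0.

(* beta_j = alpha_{j+1} + ... + alpha_k + (k - j) + alpha_{k+1}  (1-based j);
   with 0-based j this is sum_{i > j} alpha_i + (k-1-j) + a. *)
Definition beta_param (R : realType) (k : nat) (alpha : 'I_k -> R) (a : R) (j : 'I_k) : R :=
  \sum_(i < k | (j < i)%N) alpha i + (k - 1 - j)%:R + a.

(* Multivariable Kober operator of the second kind with parameters
   (zeta_j, alp_j), applied to f at u (a nonnegative function; value in \bar R). *)
Definition kober2 (R : realType) (k : nat) (zeta alp : 'I_k -> R)
  (f : k.-tuple R -> R) (u : k.-tuple R) : \bar R :=
  ((\prod_(j < k) ((tnth u j) `^ (zeta j) / Gamma (alp j)))%:E *
   lebint (fun v : k.-tuple R =>
     ((\1_[set w : k.-tuple R | forall j : 'I_k, tnth u j < tnth w j] v) *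
      (\prod_(j < k) ((tnth v j - tnth u j) `^ (alp j - 1) *
                       (tnth v j) `^ (- zeta j - alp j)))
      * f v)%:E))%E.

Definition has_density (R : realType) (d : measure_display) (T : measurableType d)
  (P : probability T R) (k : nat) (X : T -> k.-tuple R) (h : k.-tuple R -> R) : Prop :=
  forall A : set (k.-tuple R), measurable A ->
    P (X @^-1` A) = lebint (fun t => (\1_A t * h t)%:E).

Definition indep_vec (R : realType) (d : measure_display) (T : measurableType d)
  (P : probability T R) (k : nat) (X Y : T -> k.-tuple R) : Prop :=
  forall A B : set (k.-tuple R), measurable A -> measurable B ->
    P (X @^-1` A `&` Y @^-1` B) = (P (X @^-1` A) * P (Y @^-1` B))%E.

(* Main.v *)
(* Put y_j = x_j / (1 - x_1 - ... - x_(j-1)), so that u_j = v_j y_j.  For fixed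
   v, integrating out the coordinates one at a time with the remaining mass
   s = 1 - x_1 - ... - x_(j-1) as a parameter, each step is a linear
   substitution in one variable, and it turns the Dirichlet weight into the
   product of the kernels u_j^alpha_j (v_j - u_j)^(beta_j - 1) v_j^(-alpha_j - beta_j)
   on 0 < u_j < v_j.  Tonelli's theorem then exhibits C times the integral of
   this product against f as a density of u, and densities are unique almost
   everywhere.  Since alpha_j + beta_j + 1 = beta_(j-1), the Gamma factors
   telescope; the Gamma values that cancel lie between Gamma(a) and
   Gamma(alpha_1 + ... + alpha_k + k + a), whose nonvanishing follows from C <> 0,
   that is, from the Dirichlet density having mass 1. *)

Require Import Defs.
From HB Require Import structures.
From mathcomp Require Import all_boot all_order all_algebra.
From mathcomp Require Import all_classical all_reals all_analysis.
From mathcomp Require Import measurable_realfun ring.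
Set Implicit Arguments.
Unset Strict Implicit.
Unset Printing Implicit Defensive.
Import Order.TTheory GRing.Theory Num.Theory.
Import numFieldNormedType.Exports.
Local Open Scope classical_set_scope.
Local Open Scope ring_scope.

(** * Measurability of inverses and construction of measures *)

Lemma measurable_fun_invr d (T : measurableType d) (R : realType) (f : T -> R) :
  measurable_fun setT f -> measurable_fun setT (fun x => (f x)^-1).
Proof.
move=> mf.
(* The base [f x ^+ 2] is nonnegative, so its power is a true inverse; at a zero of [f] both sides
   are 0. *)
have -> : (fun x => (f x)^-1) = (fun x => f x * (f x ^+ 2) `^ (-1)).
  apply/funext => x; rewrite powR_inv1 ?sqr_ge0//.
  have [->|fx0] := eqVneq (f x) 0; first by rewrite invr0 mul0r.
  by rewrite expr2 invfM mulrA divff// mul1r.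
apply: measurable_funM => //.
apply: (measurableT_comp (measurable_powR _)).
exact: measurable_funX.
Qed.

Section density_measure.
Local Open Scope ereal_scope.
Context d (T : measurableType d) (R : realType).

(** Here and in the next two lemmas the existential form hands over a bundled measure known only
    through its set function. *)
Lemma ex_density_measure (mu : {measure set T -> \bar R}) (h : T -> \bar R) :
  measurable_fun setT h -> (forall x, 0 <= h x) ->
  exists nu : {measure set T -> \bar R},
    forall A, measurable A -> nu A = \int[mu]_(x in A) h x.
Proof.
move=> mh h0.
pose nu A := \int[mu]_(x in A) h x.
have nu0 : nu set0 = 0 by rewrite /nu integral_set0.
have nu_ge0 A : 0 <= nu A by exact: integral_ge0.
have nu_add : semi_sigma_additive nu.
  move=> F mF tF mUF.
  rewrite /nu ge0_integral_bigcup//; last exact: measurable_funTS.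
  by apply: is_cvg_nneseries => n _ _; exact: nu_ge0.
pose m := isMeasure.Build _ _ _ nu nu0 nu_ge0 nu_add.
pose nu' : {measure set T -> \bar R} := HB.pack nu m.
by exists nu'.
Qed.

End density_measure.

Lemma ex_pushforward_measure d1 d2 (T1 : measurableType d1)
    (T2 : measurableType d2) (R : realType) (mu : {measure set T1 -> \bar R})
    (phi : T1 -> T2) : measurable_fun setT phi ->
  exists nu : {measure set T2 -> \bar R}, nu = pushforward mu phi :> (_ -> _).
Proof.
by move=> mphi; unshelve eexists (pushforward mu phi : {measure set T2 -> \bar R}).
Qed.

Lemma ex_sigma_finite_measure d (T : measurableType d) (R : realType)
    (nu : {measure set T -> \bar R}) : sigma_finite setT nu ->
  exists nu' : {sigma_finite_measure set T -> \bar R}, nu' = nu :> (_ -> _).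
Proof.
case: nu => nu c /= nuS.
pose nu1 : {measure set T -> \bar R} := Measure.Pack c.
pose nu' : {sigma_finite_measure set T -> \bar R} :=
  HB.pack nu c (Measure_isSigmaFinite.Build _ _ _ nu1 nuS).
by exists nu'.
Qed.

(** The diagonal rectangles cover the product because both exhausting sequences increase. *)
Lemma sigma_finite_product_measure d1 d2 (T1 : measurableType d1)
    (T2 : measurableType d2) (R : realType)
    (m1 : {sigma_finite_measure set T1 -> \bar R})
    (m2 : {sigma_finite_measure set T2 -> \bar R}) :
  sigma_finite setT (m1 \x m2)%E.
Proof.
have /sigma_finiteP[F [TF ndF Foo]] := sigma_finiteT m1.
have /sigma_finiteP[G [TG ndG Goo]] := sigma_finiteT m2.
exists (fun n => F n `*` G n).
  rewrite -setXTT TF TG; apply/seteqP; split => [[x y] [[n _ Fn] [m _ Gm]]|].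
    exists (maxn n m) => //; split.
    - by apply: (subsetPset _ _ (ndF _ _ (leq_maxl n m)) x Fn).
    - by apply: (subsetPset _ _ (ndG _ _ (leq_maxr n m)) y Gm).
  by move=> [x y] [n _ []/= Fn Gn]; split; exists n.
move=> n; have [mF Fn] := Foo n; have [mG Gn] := Goo n.
split; first exact: measurableX.
by rewrite product_measure1E// lte_mul_pinfty// ge0_fin_numE.
Qed.

(** * Scaling of Lebesgue measure on the line *)

Section lebesgue_scaling.
Local Open Scope ereal_scope.
Context (R : realType).
Local Notation mu := (@lebesgue_measure R).

(** [c] times the image of Lebesgue measure under multiplication by [c] gives every interval []a,
    b]] its length, hence is Lebesgue measure by uniqueness. *)
Lemma ge0_integral_lebesgue_scale (c : R) (F : R -> \bar R) : (0 < c)%R ->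
  measurable_fun setT F -> (forall x, 0 <= F x) ->
  \int[mu]_x F x = c%:E * \int[mu]_x F (c * x)%R.
Proof.
move=> c0 mF F0.
pose phi := fun x : measurableTypeR R => (c * x)%R : measurableTypeR R.
have mphi : measurable_fun setT phi by exact: mulrl_measurable.
have [m mE] := ex_pushforward_measure (mu : {measure set (measurableTypeR R) -> \bar R}) mphi.
pose k : {nonneg R} := NngNum (ltW c0).
pose nu : {measure set (measurableTypeR R) -> \bar R} := mscale k m.
have E A : measurable A -> mu A = nu A.
  apply: lebesgue_measure_unique => _ [[a b] _ <-] /=.
  change (mu `]a, b]%classic = c%:E * m `]a, b]%classic).
  rewrite mE /pushforward.
  transitivity (c%:E * mu `](a / c)%R, (b / c)%R]).
    rewrite !lebesgue_measure_itv/= !lte_fin ltr_pM2r ?invr_gt0//.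
    case: ifPn => ab; last by rewrite mule0.
    by rewrite -!EFinD -mulrBl -EFinM mulrCA divff ?mulr1// gt_eqF.
  congr (_ * mu _); apply/seteqP; split => x /=;
  by rewrite !in_itv/= ltr_pdivrMr// ler_pdivlMr// mulrC.
have -> : \int[mu]_x F x = \int[nu]_x F x.
  apply: eq_measure_integral => A mA _; exact: E.
rewrite /nu ge0_integral_mscale//= mE; congr (_ * _).
by rewrite ge0_integral_pushforward.
Qed.

End lebesgue_scaling.

(** * Iterated integrals as integrals against one sigma-finite measure *)

Section tuple_lebesgue.
Local Open Scope ereal_scope.
Context (R : realType).

Lemma measurable_cons_tuple d (T : measurableType d) n (f : T -> R)
    (g : T -> n.-tuple R) :
  measurable_fun setT f -> measurable_fun setT g ->
  measurable_fun setT (fun x => cons_tuple (f x) (g x)).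
Proof. by move=> mf mg; exact: measurable_cons. Qed.

(** The measure is a Dirac mass in dimension 0, then the image under [cons_tuple] of Lebesgue
    measure times the previous one. It makes Tonelli's theorem and almost-everywhere statements
    available for [lebint]. *)
Lemma ex_tuple_lebesgue (n : nat) :
  exists mu : {sigma_finite_measure set (n.-tuple R) -> \bar R},
    forall F : n.-tuple R -> \bar R, measurable_fun setT F ->
      (forall t, 0 <= F t) -> lebint F = \int[mu]_t F t.
Proof.
elim: n => [|n [mu IH]].
  exists (\d_([tuple] : 0.-tuple R)) => F mF F0.
  by rewrite integral_dirac// diracT mul1e.
pose m0 : {measure set (measurableTypeR R * n.-tuple R)%type -> \bar R} :=
  (@lebesgue_measure R \x mu).
pose psi := fun z : measurableTypeR R * n.-tuple R => cons_tuple (z.1 : R) z.2.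
have mpsi : measurable_fun setT psi by exact: measurable_cons_tuple.
pose theta := fun t : n.+1.-tuple R =>
  ((thead t : measurableTypeR R), ([tuple of behead t] : n.-tuple R)).
have mtheta : measurable_fun setT theta.
  apply/measurable_fun_pairP; split; first exact: (@measurable_tnth _ _ _ ord0).
  exact: measurable_behead.
have psiK : cancel psi theta.
  move=> [x t]; congr pair; exact/val_inj.
have [nu nuE] := ex_pushforward_measure m0 mpsi.
have nuS : sigma_finite setT nu.
  have [F FT Fm] := sigma_finite_product_measure (@lebesgue_measure R) mu.
  (* Since [theta] undoes [psi], the preimages of the [F i] under [theta] keep the finite measure of
     [F i]. *)
  exists (fun i => theta @^-1` F i); first by rewrite -preimage_bigcup -FT.
  move=> i; have [mFi Fi] := Fm i; split.
    by rewrite -[X in measurable X]setTI; exact: mtheta.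
  rewrite nuE /pushforward (_ : _ @^-1` _ = F i)//.
  by apply/seteqP; split => z/=; rewrite psiK.
have [nu' nu'E] := ex_sigma_finite_measure nuS.
exists nu' => F mF F0 /=; rewrite nu'E.
rewrite nuE ge0_integral_pushforward//= /m0 fubini_tonelli1//; last first.
  exact: measurableT_comp.
apply: eq_integral => x _; rewrite IH//.
apply: measurableT_comp => //; exact: measurable_cons_tuple.
Qed.

End tuple_lebesgue.

Section lebint_theory.
Local Open Scope ereal_scope.
Context (R : realType).

Lemma measurable_lebint d (T : measurableType d) n (F : T -> n.-tuple R -> \bar R) :
  measurable_fun setT (fun z : T * n.-tuple R => F z.1 z.2) ->
  (forall x t, 0 <= F x t) ->
  measurable_fun setT (fun x => lebint (F x)).
Proof.
move=> mF F0; have [mu muE] := ex_tuple_lebesgue R n.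
rewrite (_ : (fun x => _) = (fun x => \int[mu]_t F x t)).
  exact: (measurable_fun_fubini_tonelli_F (m2 := mu) (fun z => F z.1 z.2)).
apply/funext => x; rewrite muE//.
exact: (measurableT_comp mF (pair1_measurable x)).
Qed.

Lemma lebint_ge0 n (F : n.-tuple R -> \bar R) : (forall t, 0 <= F t) ->
  0 <= lebint F.
Proof.
elim: n F => [|n IH] F F0 /=; first exact: F0.
by apply: integral_ge0 => x _; exact: IH.
Qed.

Lemma lebintZl n (c : R) (F : n.-tuple R -> \bar R) : (0 <= c)%R ->
  measurable_fun setT F -> (forall t, 0 <= F t) ->
  lebint (fun t => c%:E * F t) = c%:E * lebint F.
Proof.
move=> c0 mF F0; have [mu muE] := ex_tuple_lebesgue R n.
rewrite !muE//; first by rewrite ge0_integralZl.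
- exact: measurable_funeM.
- by move=> t; rewrite mule_ge0.
Qed.

End lebint_theory.

(* Cutting the power off at [x <= 0] encodes the support conditions of the
   densities in their factors. *)
Definition ppow (R : realType) (x p : R) : R := if 0 < x then x `^ p else 0.

(** One coordinate of the Kober kernel with the outer power of [u] absorbed; the cut-offs restrict
    it to [0 < u < v]. *)
Definition beta_kernel (R : realType) (al be u v : R) : R :=
  ppow u al * ppow (v - u) (be - 1) * v `^ (- al - be).

(* The unnormalised Dirichlet density of total mass [s]: [s = 1] at the start and
   [s = 1 - x_1 - ... - x_j] after [j] coordinates have been removed. *)
Definition dirichlet_weight (R : realType) n (alpha : 'I_n -> R) (a s : R)
  (x : n.-tuple R) : R :=
  (\prod_(i < n) ppow (tnth x i) (alpha i)) * ppow (s - psum x n) (a - 1).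

(* The value [beta_0] continuing the recursion beta_(j-1) = alpha_j + beta_j + 1. *)
Definition total_param (R : realType) n (alpha : 'I_n -> R) (a : R) : R :=
  \sum_(i < n) (alpha i + 1) + a.

(** * Truncated powers and the substitution in one variable *)

Section ppow_theory.
Context (R : realType).
Implicit Types x p c : R.

Lemma ppow_ge0 x p : 0 <= ppow x p.
Proof. by rewrite /ppow; case: ifPn => // _; exact: powR_ge0. Qed.

Lemma ppowM c x p : 0 < c -> ppow (c * x) p = c `^ p * ppow x p.
Proof.
move=> c0; rewrite /ppow pmulr_rgt0//; case: ifPn => [x0|_]; last by rewrite mulr0.
by rewrite powRM// ltW.
Qed.

Lemma measurable_ppow d (T : measurableType d) (f : T -> R) p :
  measurable_fun setT f -> measurable_fun setT (fun w => ppow (f w) p).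
Proof.
move=> mf; apply: measurable_fun_ifT => //.
- by apply: measurable_fun_ltr => //; exact: measurable_cst.
- exact: (measurableT_comp (measurable_powR _)).
Qed.

Lemma beta_kernel_ge0 al be u v : 0 <= @beta_kernel R al be u v.
Proof. by rewrite !mulr_ge0 ?ppow_ge0 ?powR_ge0. Qed.

Lemma measurable_beta_kernel d (T : measurableType d) (f g : T -> R) al be :
  measurable_fun setT f -> measurable_fun setT g ->
  measurable_fun setT (fun w => beta_kernel al be (f w) (g w)).
Proof.
move=> mf mg; apply: measurable_funM; first apply: measurable_funM.
- exact: measurable_ppow.
- by apply: measurable_ppow; exact: measurable_funB.
- exact: (measurableT_comp (measurable_powR _)).
Qed.

(* The substitution x = (s / v) y, with s the remaining mass. *)
Lemma beta_kernel_scale al be (s v y : R) : 0 < s -> 0 < v ->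
  (s / v) * (ppow (s / v * y) al * ppow (s - s / v * y) (be - 1)) =
  s `^ (al + be) * beta_kernel al be y v.
Proof.
move=> s0 v0; have c0 : 0 < s / v by rewrite divr_gt0.
have -> : s - s / v * y = s / v * (v - y).
  by rewrite mulrBr divfK// gt_eqF.
rewrite !ppowM// /beta_kernel.
have -> : s / v * ((s / v) `^ al * ppow y al * ((s / v) `^ (be - 1) * ppow (v - y) (be - 1)))
  = (s / v) `^ 1 * (s / v) `^ (be - 1) * (s / v) `^ al * (ppow y al * ppow (v - y) (be - 1)).
  by rewrite powRr1 ?ltW//; ring.
(* Adding exponents asks for a nonzero base when their sum is 0; [s / v] is positive throughout. *)
have nz : forall q, q ==> (s / v != 0) by move=> q; rewrite (gt_eqF c0) implybT.
rewrite -!powRD ?nz//.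
have -> : 1 + (be - 1) + al = al + be by ring.
have -> : (s / v) `^ (al + be) = s `^ (al + be) * v `^ (- al - be).
  by rewrite powRM ?invr_ge0 ?ltW// -powR_inv1 ?ltW// -powRrM mulN1r opprD.
by ring.
Qed.

End ppow_theory.

(** * Removing the first coordinate of a Dirichlet weight *)

Section dirichlet_weight_theory.
Context (R : realType).

Lemma measurable_psum d (T : measurableType d) n (f : T -> n.-tuple R) j :
  measurable_fun setT f -> measurable_fun setT (fun x => psum (f x) j).
Proof.
move=> mf.
rewrite (_ : (fun _ => _) =
    fun x => \sum_(i < n) if (i < j)%N then tnth (f x) i else 0); last first.
  by apply/funext => x; rewrite /psum big_mkcond.
apply: measurable_sum => i; case: (i < j)%N => //.
exact: (measurableT_comp (measurable_tnth i)).
Qed.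

Lemma psum0 n (x : n.-tuple R) : psum x 0 = 0.
Proof. by rewrite /psum big_pred0. Qed.

Lemma psum_cons n x (t : n.-tuple R) j : psum (cons_tuple x t) j.+1 = x + psum t j.
Proof.
rewrite /psum big_mkcond big_ord_recl/= tnth0; congr (_ + _).
rewrite [RHS]big_mkcond; apply: eq_bigr => i _.
by rewrite tnthS.
Qed.

Lemma measurable_dirichlet_weight d (T : measurableType d) n
    (alpha : 'I_n -> R) (a : R) (s : T -> R) (f : T -> n.-tuple R) :
  measurable_fun setT s -> measurable_fun setT f ->
  measurable_fun setT (fun x => dirichlet_weight alpha a (s x) (f x)).
Proof.
move=> ms mf; apply: measurable_funM.
  apply: measurable_prod => i _; apply: measurable_ppow.
  exact: (measurableT_comp (measurable_tnth i)).
by apply: measurable_ppow; apply: measurable_funB => //; exact: measurable_psum.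
Qed.

Lemma dirichlet_weight_ge0 n (alpha : 'I_n -> R) a s x :
  0 <= dirichlet_weight alpha a s x.
Proof. by rewrite mulr_ge0 ?prodr_ge0 ?ppow_ge0// => i _; exact: ppow_ge0. Qed.

Lemma dirichlet_weight_cons n (alpha : 'I_n.+1 -> R) a s x (t : n.-tuple R) :
  dirichlet_weight alpha a s (cons_tuple x t) =
  ppow x (alpha ord0) *
    dirichlet_weight (fun i => alpha (lift ord0 i)) a (s - x) t.
Proof.
rewrite /dirichlet_weight big_ord_recl tnth0 -mulrA psum_cons opprD addrA.
by under eq_bigr do rewrite tnthS.
Qed.

Lemma beta_param_lift n (alpha : 'I_n.+1 -> R) a (j : 'I_n) :
  beta_param alpha a (lift ord0 j) = beta_param (fun i => alpha (lift ord0 i)) a j.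
Proof.
rewrite /beta_param big_mkcond big_ord_recl/= add0r; congr (_ + _ + _).
  by rewrite [RHS]big_mkcond.
by rewrite /bump/= subSS subn0 -subnDA.
Qed.

(** This links the induction: integrating out the later coordinates leaves the remaining mass to the
    power [total_param - 1], which is the exponent wanted in the first [beta_kernel]. *)
Lemma beta_param_ord0 n (alpha : 'I_n.+1 -> R) a :
  beta_param alpha a ord0 = total_param (fun i => alpha (lift ord0 i)) a.
Proof.
rewrite /beta_param /total_param big_mkcond big_ord_recl/= add0r.
by rewrite subn0 subn1/= big_split/= sumr_const card_ord.
Qed.

Lemma total_param_recl n (alpha : 'I_n.+1 -> R) a :
  total_param alpha a = alpha ord0 + 1 + beta_param alpha a ord0.
Proof. by rewrite beta_param_ord0 /total_param big_ord_recl addrA. Qed.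

End dirichlet_weight_theory.

(** * Change of variables from [x] to [u] for fixed [v] *)

Definition stick_map (R : realType) n (s : R) (x v : n.-tuple R) : n.-tuple R :=
  [tuple tnth v j * (tnth x j / (s - psum x j)) | j < n].

Definition kober_kernel (R : realType) n (alpha : 'I_n -> R) (a : R)
  (u v : n.-tuple R) : R :=
  \prod_(j < n) beta_kernel (alpha j) (beta_param alpha a j) (tnth u j) (tnth v j).

Section change_of_variables.
Context (R : realType).

Lemma measurable_stick_map d (T : measurableType d) n (s : T -> R)
    (f g : T -> n.-tuple R) :
  measurable_fun setT s -> measurable_fun setT f -> measurable_fun setT g ->
  measurable_fun setT (fun w => stick_map (s w) (f w) (g w)).
Proof.
move=> ms mf mg; apply/measurable_fun_tnthP => j.
rewrite (_ : _ \o _ = fun w => tnth (g w) j * (tnth (f w) j / (s w - psum (f w) j))).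
  apply: measurable_funM; first exact: (measurableT_comp (measurable_tnth j)).
  apply: measurable_funM; first exact: (measurableT_comp (measurable_tnth j)).
  apply: measurable_fun_invr; apply: measurable_funB => //.
  exact: measurable_psum.
by apply/funext => w /=; rewrite tnth_mktuple.
Qed.

(** The mass [s] is a parameter so that the tail is again a [stick_map]: its denominators are
    [s - x] minus partial sums of the tail. *)
Lemma stick_map_cons n (s x v : R) (t w : n.-tuple R) :
  stick_map s (cons_tuple x t) (cons_tuple v w) =
  cons_tuple (v * (x / s)) (stick_map (s - x) t w).
Proof.
apply: eq_from_tnth => j; rewrite tnth_mktuple.
have [j' ->|->] := unliftP ord0 j.
  by rewrite !tnthS tnth_mktuple psum_cons opprD addrA.
by rewrite !tnth0 psum0 subr0.
Qed.

Lemma kober_kernel_ge0 n (alpha : 'I_n -> R) a u v : 0 <= kober_kernel alpha a u v.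
Proof. by apply: prodr_ge0 => j _; exact: beta_kernel_ge0. Qed.

Lemma measurable_kober_kernel d (T : measurableType d) n (alpha : 'I_n -> R) a
    (f g : T -> n.-tuple R) :
  measurable_fun setT f -> measurable_fun setT g ->
  measurable_fun setT (fun w => kober_kernel alpha a (f w) (g w)).
Proof.
move=> mf mg; apply: measurable_prod => j _; apply: measurable_beta_kernel;
  exact: (measurableT_comp (measurable_tnth j)).
Qed.

Lemma kober_kernel_cons n (alpha : 'I_n.+1 -> R) a (x v : R) (t w : n.-tuple R) :
  kober_kernel alpha a (cons_tuple x t) (cons_tuple v w) =
  beta_kernel (alpha ord0) (beta_param alpha a ord0) x v *
    kober_kernel (fun i => alpha (lift ord0 i)) a t w.
Proof.
rewrite /kober_kernel big_ord_recl !tnth0; congr (_ * _).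
by apply: eq_bigr => j _; rewrite !tnthS beta_param_lift.
Qed.

(** Either some coordinate is not positive, or all are and the mass left over is at most 0; a
    cut-off factor vanishes in both cases. *)
Lemma dirichlet_weight_le0 n (alpha : 'I_n -> R) a s x : s <= 0 ->
  dirichlet_weight alpha a s x = 0.
Proof.
move=> s0; rewrite /dirichlet_weight.
have [xpos|/existsNP[i /negP xi]] := pselect (forall i, 0 < tnth x i).
  rewrite [X in _ * X]/ppow subr_gt0 ltNge (le_trans s0) ?mulr0//.
  by apply: sumr_ge0 => i _; exact: ltW.
by rewrite (bigD1 i)//= {1}/ppow (negbTE xi) !mul0r.
Qed.

Local Open Scope ereal_scope.

(** Induction on [n] with [s], [v] and [Phi] free: the tail has mass [s - x], and the new [Phi]
    absorbs the first output coordinate. *)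
Lemma lebint_stick_map n (alpha : 'I_n -> R) (a s : R) (v : n.-tuple R)
    (Phi : n.-tuple R -> \bar R) :
  (0 < s)%R -> (forall i, 0 < tnth v i)%R ->
  measurable_fun setT Phi -> (forall u, 0 <= Phi u) ->
  lebint (fun x => (dirichlet_weight alpha a s x)%:E * Phi (stick_map s x v)) =
  (s `^ (total_param alpha a - 1))%:E *
    lebint (fun u => (kober_kernel alpha a u v)%:E * Phi u).
Proof.
elim: n alpha s v Phi => [|n IH] alpha s v Phi s0 v0 mPhi Phi0.
  rewrite /= /dirichlet_weight /kober_kernel /total_param !big_ord0 mul1r mul1e.
  rewrite psum0 subr0 add0r /ppow s0; congr (_ * Phi _); exact: tuple0.
case/tupleP: v v0 => v w vw0.
have v0 : (0 < v)%R by have := vw0 ord0; rewrite tnth0.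
have w0 i : (0 < tnth w i)%R by have := vw0 (lift ord0 i); rewrite tnthS.
pose alpha' := fun i => alpha (lift ord0 i).
(* [L y] is the transformed tail integral once the first output coordinate equals [y]; it no longer
   depends on [s]. *)
pose L y := lebint (fun t : n.-tuple R =>
  (kober_kernel alpha' a t w)%:E * Phi (cons_tuple y t)).
have mcons y : measurable_fun setT (fun t : n.-tuple R => cons_tuple y t).
  by apply: measurable_cons_tuple => //; exact: measurable_cst.
have L0 y : 0 <= L y.
  by apply: lebint_ge0 => t; rewrite mule_ge0// lee_fin kober_kernel_ge0.
have mL : measurable_fun setT L.
  apply: measurable_lebint => [|x t]; last first.
    by rewrite mule_ge0// lee_fin kober_kernel_ge0.
  apply: emeasurable_funM; last first.
    by apply: measurableT_comp => //; exact: measurable_cons_tuple.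
  apply/measurable_EFinP; apply: measurable_kober_kernel => //.
have step x : lebint (fun t : n.-tuple R =>
    (dirichlet_weight alpha a s (cons_tuple x t))%:E *
      Phi (stick_map s (cons_tuple x t) (cons_tuple v w))) =
    (ppow x (alpha ord0) * ppow (s - x) (beta_param alpha a ord0 - 1))%:E *
      L (v * (x / s))%R.
  under [in LHS](@eq_fun _ _ _) => t.
    rewrite dirichlet_weight_cons stick_map_cons EFinM -muleA.
    over.
  have mW : measurable_fun setT (fun t : n.-tuple R =>
    (dirichlet_weight alpha' a (s - x)%R t)%:E *
      Phi (cons_tuple (v * (x / s))%R (stick_map (s - x)%R t w))).
    apply: emeasurable_funM.
      apply/measurable_EFinP/measurable_dirichlet_weight => //.
    apply: measurableT_comp => //; apply: measurable_cons_tuple.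
      exact: measurable_cst.
    by apply: measurable_stick_map => //; exact: measurable_cst.
  rewrite lebintZl ?ppow_ge0//; last first.
    by move=> t; rewrite mule_ge0// lee_fin dirichlet_weight_ge0.
  (* For [x >= s] no mass is left and both sides vanish; for [x < s] the induction hypothesis
     applies at mass [s - x]. *)
  have [xs|sx] := ltP x s; last first.
    rewrite [ppow (s - x) _]/ppow subr_gt0 ltNge sx/= mulr0 mul0e.
    rewrite (_ : (fun _ => _) = (fun t : n.-tuple R => 0%:E * 1)); last first.
      apply/funext => t.
      by rewrite dirichlet_weight_le0 ?subr_le0// !mul0e.
    by rewrite lebintZl ?mul0e ?mule0.
  rewrite EFinM -muleA; congr (_ * _).
  rewrite (IH alpha' (s - x)%R w (fun t => Phi (cons_tuple (v * (x / s))%R t)))//.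
  - by rewrite beta_param_ord0 /ppow subr_gt0 xs.
  - by rewrite subr_gt0.
  - exact: measurableT_comp.
transitivity (\int[@lebesgue_measure R]_x
    ((ppow x (alpha ord0) * ppow (s - x) (beta_param alpha a ord0 - 1))%:E *
      L (v * (x / s))%R)).
  by apply: eq_integral => x _; exact: step.
have c0 : (0 < s / v)%R by rewrite divr_gt0.
pose q := beta_kernel (alpha ord0) (beta_param alpha a ord0).
have mqL : measurable_fun setT (fun y => (q y v)%:E * L y).
  apply: emeasurable_funM => //; apply/measurable_EFinP.
  by apply: measurable_beta_kernel => //; exact: measurable_cst.
have q0 y : 0 <= (q y v)%:E * L y.
  by rewrite mule_ge0// lee_fin beta_kernel_ge0.
transitivity ((s `^ (total_param alpha a - 1))%:E *
    \int[@lebesgue_measure R]_y ((q y v)%:E * L y)); last first.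
  congr (_ * _); rewrite [RHS]/=; apply: eq_integral => y _.
  rewrite -lebintZl ?beta_kernel_ge0//; last 2 first.
  - apply: emeasurable_funM; last exact: measurableT_comp.
    apply/measurable_EFinP/measurable_kober_kernel => //; exact: measurable_cst.
  - by move=> t; rewrite mule_ge0// lee_fin kober_kernel_ge0.
  congr lebint; apply/funext => t.
  by rewrite kober_kernel_cons EFinM muleA.
rewrite -ge0_integralZl//; last by rewrite lee_fin powR_ge0.
(* The substitution [x = (s / v) y] turns the first output [v (x / s)] into [y]. *)
rewrite (ge0_integral_lebesgue_scale c0); last 2 first.
- apply: emeasurable_funM.
    apply/measurable_EFinP; apply: measurable_funM; apply: measurable_ppow => //.
    by apply: measurable_funB => //; exact: measurable_cst.
  apply: measurableT_comp => //; apply: measurable_funM; first exact: measurable_cst.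
  by apply: measurable_funM => //; exact: measurable_cst.
- by move=> x; rewrite mule_ge0// lee_fin mulr_ge0 ?ppow_ge0.
rewrite -ge0_integralZl//; last 3 first.
- apply: emeasurable_funM.
    apply/measurable_EFinP; apply: measurable_funM; apply: measurable_ppow => //;
    try (apply: measurable_funB; first exact: measurable_cst);
    exact: mulrl_measurable.
  apply: measurableT_comp => //; apply: measurable_funM; first exact: measurable_cst.
  apply: measurable_funM; last exact: measurable_cst.
  exact: mulrl_measurable.
- by move=> y _; rewrite mule_ge0// lee_fin mulr_ge0 ?ppow_ge0.
- by rewrite lee_fin ltW.
apply: eq_integral => y _.
have -> : (v * (s / v * y / s) = y)%R.
  by field; rewrite !gt_eqF.
rewrite !muleA -!EFinM beta_kernel_scale//.
by congr ((_ `^ _ * _)%:E * _); rewrite total_param_recl; ring.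
Qed.

End change_of_variables.

(** * Positivity of Gamma values and their telescoping product *)

Section gamma.
Context (R : realType).

Let gamma_integrand (s t : R) : R := t `^ (s - 1) * expR (- t).

Let gamma_integrand_gt0 s t : 0 < t -> 0 < gamma_integrand s t.
Proof. by move=> t0; rewrite mulr_gt0 ?powR_gt0 ?expR_gt0. Qed.

Let gamma_integrand_ge0 s t : 0 <= gamma_integrand s t.
Proof. by rewrite mulr_ge0 ?powR_ge0 ?expR_ge0. Qed.

Let measurable_gamma_integrand s (D : set R) :
  measurable_fun D (EFin \o gamma_integrand s).
Proof.
apply: measurable_funTS; apply/measurable_EFinP; apply: measurable_funM.
  exact: measurable_powR.
by apply: measurableT_comp => //; exact: measurable_expR.
Qed.

Lemma Gamma_ge0 (s : R) : 0 <= Gamma s.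
Proof. by apply: fine_ge0; apply: integral_ge0 => t _; rewrite lee_fin gamma_integrand_ge0. Qed.

(** [fine] maps an infinite integral to 0, so a nonzero value of [Gamma] certifies convergence. *)
Lemma Gamma_neq0_lty (s : R) : Gamma s != 0 ->
  (\int[@lebesgue_measure R]_(t in `]0%R, +oo[) (gamma_integrand s t)%:E < +oo)%E.
Proof.
rewrite /Gamma; apply: contra_neqT; rewrite -leNgt leye_eq => /eqP E.
by rewrite [X in fine X]E.
Qed.

(* No bound on the Euler integral is needed: its integrand at [s] is at most
   the sum of the integrands at [s1] and [s2]. *)
Lemma Gamma_gt0_between (s1 s s2 : R) : Gamma s1 != 0 -> Gamma s2 != 0 ->
  s1 <= s -> s <= s2 -> 0 < Gamma s.
Proof.
move=> /Gamma_neq0_lty G1 /Gamma_neq0_lty G2 s1s ss2.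
set D := `]0%R, +oo[%classic : set R in G1 G2.
have mD : measurable D by exact: measurable_itv.
apply: fine_gt0; rewrite -/D; apply/andP; split.
  rewrite lt_neqAle integral_ge0 ?andbT; last by move=> t _; rewrite lee_fin gamma_integrand_ge0.
  (* A zero integral would make the positive integrand vanish almost everywhere on the half-line,
     which has infinite measure. *)
  apply/eqP => /esym I0.
  have /(ae_eq_integral_abs (@lebesgue_measure R) mD (measurable_gamma_integrand s (D := D))) :
      (\int[@lebesgue_measure R]_(t in D) `|(EFin \o gamma_integrand s) t| = 0)%E.
    rewrite -[RHS]I0; apply: eq_integral => t _.
    by rewrite gee0_abs ?lee_fin ?gamma_integrand_ge0.
  move=> negD.
  have /measure_negligible : (@lebesgue_measure R).-negligible D.
    apply: (negligibleS _ negD) => t Dt /= /(_ Dt) [] /eqP; rewrite gt_eqF//.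
    by apply: gamma_integrand_gt0; move: Dt; rewrite /D /= in_itv/= andbT.
  move=> /(_ mD) D0.
  have := @lebesgue_measure_itv R `]0%R, +oo[.
  by rewrite /= ltry => Dy; have := etrans (esym D0) Dy.
apply: (@le_lt_trans _ _ (\int[@lebesgue_measure R]_(t in D)
    ((gamma_integrand s1 t)%:E + (gamma_integrand s2 t)%:E))%E).
  apply: ge0_le_integral => //.
  - by move=> t _; rewrite lee_fin gamma_integrand_ge0.
  - exact: measurable_gamma_integrand.
  - by apply: emeasurable_funD; exact: measurable_gamma_integrand.
  - move=> t; rewrite /D/= in_itv/= andbT => t0.
    rewrite -EFinD lee_fin -mulrDl ler_pM2r ?expR_gt0//.
    (* Up to 1 the smaller exponent dominates, beyond 1 the larger. *)
    have [t1|/ltW t1] := leP t 1.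
      rewrite (@le_trans _ _ (t `^ (s1 - 1)))//; last by rewrite lerDl powR_ge0.
      by rewrite ger_powR ?t0 ?t1// lerB.
    rewrite (@le_trans _ _ (t `^ (s2 - 1)))//; last by rewrite lerDr powR_ge0.
    by rewrite ler_powR// lerB.
rewrite ge0_integralD//; first by rewrite lte_add_pinfty.
- by move=> t _; rewrite lee_fin gamma_integrand_ge0.
- exact: measurable_gamma_integrand.
- by move=> t _; rewrite lee_fin gamma_integrand_ge0.
- exact: measurable_gamma_integrand.
Qed.

Lemma total_param_ge n (alpha : 'I_n -> R) a :
  (forall j, -1 < alpha j) -> a <= total_param alpha a.
Proof.
move=> alpha1; rewrite /total_param lerDr; apply: sumr_ge0 => i _.
by rewrite -lerBlDr sub0r ltW.
Qed.

(** Since [alpha j + 1 > 0], this puts both Gamma arguments attached to [j] in the range of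
    [Gamma_gt0_between], with endpoints [a] and [total_param alpha a]. *)
Lemma beta_param_bounds n (alpha : 'I_n -> R) a j :
  (forall j, -1 < alpha j) ->
  a <= beta_param alpha a j /\ alpha j + beta_param alpha a j + 1 <= total_param alpha a.
Proof.
elim: n alpha j => [|n IH] alpha j alpha1; first by case: j.
have alpha1' i : -1 < alpha (lift ord0 i) by exact: alpha1.
have [j' ->|->] := unliftP ord0 j.
  rewrite beta_param_lift; have [? H] := IH _ j' alpha1'; split=> //.
  rewrite (le_trans H)// total_param_recl beta_param_ord0 lerDr.
  by rewrite -lerBlDr sub0r ltW.
split; first by rewrite beta_param_ord0 total_param_ge.
by rewrite total_param_recl addrAC.
Qed.

(** By [alpha_j + beta_j + 1 = beta_(j-1)] the two products run over one sequence shifted by an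
    index, with end terms at the total parameter and at [a]. Only this recursion enters, so [G] is
    arbitrary. *)
Lemma prod_beta_param_telescope (G : R -> R) n (alpha : 'I_n -> R) a : G a != 0 ->
  (forall j, G (beta_param alpha a j) != 0) ->
  (forall j, G (alpha j + beta_param alpha a j + 1) != 0) ->
  G (total_param alpha a) / G a *
    \prod_(j < n) (G (alpha j + beta_param alpha a j + 1))^-1 =
  \prod_(j < n) (G (beta_param alpha a j))^-1.
Proof.
elim: n alpha => [|n IH] alpha Ga Gb Gab.
  by rewrite /total_param !big_ord0 add0r mulr1 divff.
pose alpha' := fun i => alpha (lift ord0 i).
have Gb' j : G (beta_param alpha' a j) != 0.
  by have := Gb (lift ord0 j); rewrite beta_param_lift.
have Gab' j : G (alpha' j + beta_param alpha' a j + 1) != 0.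
  by have := Gab (lift ord0 j); rewrite beta_param_lift.
have E1 : \prod_(j < n.+1) (G (alpha j + beta_param alpha a j + 1))^-1 =
    (G (alpha ord0 + beta_param alpha a ord0 + 1))^-1 *
    \prod_(j < n) (G (alpha' j + beta_param alpha' a j + 1))^-1.
  by rewrite big_ord_recl; congr (_ * _); apply: eq_bigr => j _;
    rewrite beta_param_lift.
have E2 : \prod_(j < n.+1) (G (beta_param alpha a j))^-1 =
    (G (beta_param alpha a ord0))^-1 *
    \prod_(j < n) (G (beta_param alpha' a j))^-1.
  by rewrite big_ord_recl; congr (_ * _); apply: eq_bigr => j _;
    rewrite beta_param_lift.
rewrite E1 E2 -(IH alpha' Ga Gb' Gab') total_param_recl.
have := Gb ord0; have := Gab ord0; rewrite -addrA [_ + 1]addrC addrA.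
rewrite beta_param_ord0 -/alpha' => H1 H2.
by field; rewrite H1 H2 Ga.
Qed.

End gamma.

(** * Joint density of independent vectors *)

Section joint_density.
Local Open Scope ereal_scope.
Context d d1 d2 (T : measurableType d) (S1 : measurableType d1)
  (S2 : measurableType d2) (R : realType) (P : probability T R).

(** The law of the pair, the product of the marginal laws and the measure with density [h1 x * h2 y]
    agree on rectangles, hence everywhere by uniqueness of product measures. The inner integral is
    over [x], ready for a change of variables at fixed [y]. *)
Lemma indep_joint_density (mu1 : {sigma_finite_measure set S1 -> \bar R})
    (mu2 : {sigma_finite_measure set S2 -> \bar R})
    (X : T -> S1) (Y : T -> S2) (h1 : S1 -> R) (h2 : S2 -> R) :
  measurable_fun setT X -> measurable_fun setT Y ->
  measurable_fun setT h1 -> (forall x, 0 <= h1 x)%R ->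
  measurable_fun setT h2 -> (forall y, 0 <= h2 y)%R ->
  (forall A, measurable A -> P (X @^-1` A) = \int[mu1]_x (\1_A x * h1 x)%:E) ->
  (forall B, measurable B -> P (Y @^-1` B) = \int[mu2]_y (\1_B y * h2 y)%:E) ->
  (forall A B, measurable A -> measurable B ->
    P (X @^-1` A `&` Y @^-1` B) = P (X @^-1` A) * P (Y @^-1` B)) ->
  forall C, measurable C -> P [set w | C (X w, Y w)] =
    \int[mu2]_y \int[mu1]_x (\1_C (x, y) * (h1 x * h2 y))%:E.
Proof.
move=> mX mY mh1 h10 mh2 h20 PX PY PXY C mC.
pose X' : {mfun T >-> S1} := HB.pack X (isMeasurableFun.Build _ _ _ _ X mX).
pose Y' : {mfun T >-> S2} := HB.pack Y (isMeasurableFun.Build _ _ _ _ Y mY).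
have mXY : measurable_fun setT (fun w => (X w, Y w)).
  exact/measurable_fun_pairP.
have [nu nuE] := ex_pushforward_measure P mXY.
pose hh (z : S1 * S2) : R := (h1 z.1 * h2 z.2)%R.
have mhh : measurable_fun setT hh.
  by apply: measurable_funM; exact: measurableT_comp.
have hh0 z : (0 <= hh z)%R by rewrite mulr_ge0.
have [Q QE] := ex_density_measure (mu1 \x mu2 : {measure set (S1 * S2) -> \bar R})
  (proj2 (measurable_EFinP _ _) mhh) (fun z => hh0 z : 0 <= (hh z)%:E).
have QI (D : set (S1 * S2)) : measurable D ->
    Q D = \int[mu1 \x mu2]_z (\1_D z * hh z)%:E.
  move=> mD; rewrite QE// integral_mkcond; apply: eq_integral => z _.
  by rewrite patchE indicE; case: ifPn => _; rewrite ?mul1r ?mul0r.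
have m1h (D : set (S1 * S2)) : measurable D ->
    measurable_fun setT (fun z => (\1_D z * hh z)%:E).
  move=> mD; apply/measurable_EFinP; apply: measurable_funM => //.
have h1h0 (D : set (S1 * S2)) z : 0 <= (\1_D z * hh z)%:E.
  by rewrite lee_fin mulr_ge0.
have E1 : (distribution P X' \x distribution P Y') C = nu C.
  apply: product_measure_unique => // A B mA mB.
  by rewrite nuE; exact: PXY.
have E2 : (distribution P X' \x distribution P Y') C = Q C.
  apply: product_measure_unique => // A B mA mB.
  rewrite QI; last exact: measurableX.
  rewrite (fubini_tonelli1 (fun z => (\1_(A `*` B) z * hh z)%:E))//; last first.
    by apply: m1h; exact: measurableX.
  change (\int[mu1]_x \int[mu2]_y (\1_(A `*` B) (x, y) * hh (x, y))%:E =
    P (X @^-1` A) * P (Y @^-1` B)).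
  rewrite PX// PY//.
  rewrite -ge0_integralZr//; last 3 first.
  - by apply/measurable_EFinP; exact: measurable_funM.
  - by move=> x _; rewrite lee_fin mulr_ge0.
  - by apply: integral_ge0 => y _; rewrite lee_fin mulr_ge0.
  apply: eq_integral => x _; rewrite -ge0_integralZl//; last 3 first.
  - by apply/measurable_EFinP; exact: measurable_funM.
  - by move=> y _; rewrite lee_fin mulr_ge0.
  - by rewrite lee_fin mulr_ge0.
  apply: eq_integral => y _; rewrite -EFinM /hh/=; congr (_%:E).
  by rewrite !indicE in_setX/= -mulnb natrM; ring.
transitivity (nu C); first by rewrite nuE.
rewrite -E1 E2 QI//.
by rewrite (fubini_tonelli2 (fun z => (\1_C z * hh z)%:E))//; exact: m1h.
Qed.

End joint_density.

(** * The Dirichlet density and the Kober operator in terms of cut-off powers *)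

Section dirichlet.
Context (R : realType).

(** Positive coordinates with sum below 1 are each below 1, and their sum is positive because
    [0 < k], so the cut-offs reproduce the support. *)
Lemma dirichlet1_densityE k (alpha : 'I_k -> R) a (x : k.-tuple R) : (0 < k)%N ->
  dirichlet1_density alpha a x =
  dirichlet1_const alpha a * dirichlet_weight alpha a 1 x.
Proof.
move=> k0; rewrite /dirichlet1_density /dirichlet_weight.
case: asboolP => [[x01 /andP[_ x1]]|nx].
  rewrite mulrA [ppow (1 - _) _]/ppow subr_gt0 x1; congr (_ * _ * _).
  by apply: eq_bigr => i _; have /andP[xi _] := x01 i; rewrite /ppow xi.
have [xpos|/existsNP[i /negP xi]] := pselect (forall i, 0 < tnth x i); last first.
  by rewrite (bigD1 i)//= {1}/ppow (negbTE xi) !mul0r mulr0.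
rewrite [ppow (1 - _) _]/ppow subr_gt0; case: ifPn => [x1|_]; last by rewrite !mulr0.
have psumE : psum x k = \sum_(i < k) tnth x i.
  by apply: eq_bigl => i; rewrite ltn_ord.
have le_psum i : tnth x i <= psum x k.
  by rewrite psumE (bigD1 i)//= lerDl; apply: sumr_ge0 => j _; exact: ltW.
exfalso; apply: nx; split=> [i|]; first by rewrite xpos (le_lt_trans (le_psum i)).
by rewrite x1 andbT (lt_le_trans (xpos (Ordinal k0))).
Qed.

Lemma dirichlet1_constE k (alpha : 'I_k -> R) a :
  dirichlet1_const alpha a =
  Gamma (total_param alpha a) / ((\prod_(i < k) Gamma (alpha i + 1)) * Gamma a).
Proof.
rewrite /dirichlet1_const /total_param big_split/= sumr_const card_ord.
by rewrite addrAC.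
Qed.

Lemma dirichlet1_const_ge0 k (alpha : 'I_k -> R) a : 0 <= dirichlet1_const alpha a.
Proof.
rewrite divr_ge0 ?Gamma_ge0// mulr_ge0 ?Gamma_ge0//.
by apply: prodr_ge0 => i _; exact: Gamma_ge0.
Qed.

Lemma dirichlet1_const_beta k (alpha : 'I_k -> R) a :
  (forall j, -1 < alpha j) -> dirichlet1_const alpha a != 0 ->
  \prod_(j < k) (Gamma (alpha j + 1) / Gamma (alpha j + beta_param alpha a j + 1))
    * dirichlet1_const alpha a = \prod_(j < k) (Gamma (beta_param alpha a j))^-1.
Proof.
move=> alpha1; rewrite dirichlet1_constE => C0.
(* With [0^-1 = 0], a zero in the numerator or in the denominator would force the constant to be
   0. *)
have Gt : Gamma (total_param alpha a) != 0.
  by apply: contra_neq C0 => ->; rewrite mul0r.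
have Ga : Gamma a != 0.
  by apply: contra_neq C0 => ->; rewrite mulr0 invr0 mulr0.
have Gp : \prod_(i < k) Gamma (alpha i + 1) != 0.
  by apply: contra_neq C0 => ->; rewrite mul0r invr0 mulr0.
have alpha1_ge0 j : 0 <= alpha j + 1 by rewrite -lerBlDr sub0r ltW.
have Gb j : Gamma (beta_param alpha a j) != 0.
  have [b1 b2] := beta_param_bounds a j alpha1.
  rewrite gt_eqF// (Gamma_gt0_between Ga Gt)// (le_trans _ b2)//.
  by rewrite addrAC lerDr.
have Gab j : Gamma (alpha j + beta_param alpha a j + 1) != 0.
  have [b1 b2] := beta_param_bounds a j alpha1.
  rewrite gt_eqF// (Gamma_gt0_between Ga Gt)// (le_trans b1)//.
  by rewrite addrAC lerDr.
rewrite -(prod_beta_param_telescope Ga Gb Gab) big_split/=.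
move: Gp Ga; move: (\prod_(j < k) (Gamma _)^-1) (\prod_(j < k) Gamma _).
move: (Gamma a) (Gamma (total_param alpha a)) => x y p q q0 x0.
by field; rewrite q0 x0.
Qed.

Lemma kober_kernelE k (alpha : 'I_k -> R) a (u v : k.-tuple R) :
  positive_orthant u ->
  kober_kernel alpha a u v =
  \prod_(j < k) tnth u j `^ alpha j *
  (\1_[set w : k.-tuple R | forall j, tnth u j < tnth w j] v *
   \prod_(j < k) ((tnth v j - tnth u j) `^ (beta_param alpha a j - 1) *
     tnth v j `^ (- alpha j - beta_param alpha a j))).
Proof.
move=> u0; rewrite indicE.
have [/[!inE]/= uv|/negP] := boolP (v \in _).
  rewrite mul1r /kober_kernel -big_split/=; apply: eq_bigr => j _.
  by rewrite /beta_kernel /ppow subr_gt0 uv u0 mulrA.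
rewrite inE/= => /existsNP[j /negP uvj]; rewrite mul0r mulr0.
by rewrite /kober_kernel (bigD1 j)//= /beta_kernel [ppow (_ - _) _]/ppow subr_gt0
  (negbTE uvj) mulr0 !mul0r.
Qed.

(** For [u] in the orthant the product [p] of powers of [u] is a positive constant, so it moves into
    the integral and completes [kober_kernel]. *)
Lemma kober2E k (alpha : 'I_k -> R) a (f : k.-tuple R -> R) (u : k.-tuple R) :
  measurable_fun setT f -> (forall v, 0 <= f v) -> positive_orthant u ->
  kober2 alpha (beta_param alpha a) f u =
  ((\prod_(j < k) (Gamma (beta_param alpha a j))^-1)%:E *
    lebint (fun v => (kober_kernel alpha a u v * f v)%:E))%E.
Proof.
move=> mf f0 u0; rewrite /kober2.
set p := \prod_(j < k) tnth u j `^ alpha j.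
have p0 : 0 < p by apply: prodr_gt0 => j _; exact: powR_gt0.
pose F v := \1_[set w : k.-tuple R | forall j, tnth u j < tnth w j] v *
   \prod_(j < k) ((tnth v j - tnth u j) `^ (beta_param alpha a j - 1) *
     tnth v j `^ (- alpha j - beta_param alpha a j)) * f v.
have KF v : kober_kernel alpha a u v * f v = p * F v.
  by rewrite kober_kernelE// /F -!mulrA.
have FK v : F v = p^-1 * (kober_kernel alpha a u v * f v).
  by rewrite KF mulKf// gt_eqF.
rewrite (_ : (fun v => (kober_kernel _ _ _ _ * _)%:E) =
    fun v => (p%:E * (F v)%:E)%E); last by apply/funext => v; rewrite KF EFinM.
rewrite lebintZl ?ltW//.
- by rewrite big_split/= EFinM -muleA muleCA.
- apply/measurable_EFinP; rewrite (_ : F = fun v => p^-1 * (kober_kernel alpha a u v * f v));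
    last exact/funext.
  by apply: measurable_funM => //; apply: measurable_funM => //;
    apply: measurable_kober_kernel.
- move=> v; rewrite lee_fin FK mulr_ge0//; first by rewrite invr_ge0 ltW.
  by rewrite mulr_ge0// kober_kernel_ge0.
Qed.

End dirichlet.

(** * The density of [u] as a Kober integral *)

Section kober_density.
Local Open Scope ereal_scope.
Context (R : realType) (k : nat) (alpha : 'I_k -> R) (a : R).
Variable mu : {sigma_finite_measure set (k.-tuple R) -> \bar R}.
Hypothesis muE : forall F : k.-tuple R -> \bar R, measurable_fun setT F ->
  (forall t, 0 <= F t) -> lebint F = \int[mu]_t F t.

(** [lebint_stick_map] at mass 1, where its prefactor is 1, with the indicator of [A] as test
    function. Off the orthant [y], later [f v], is 0 and kills both sides. *)
Let integral_stick_map (c : R) (A : set (k.-tuple R)) (v : k.-tuple R) (y : R) :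
  (0 <= c)%R -> (0 <= y)%R -> measurable A -> (~ positive_orthant v -> y = 0%R) ->
  \int[mu]_x (\1_A (stick_map 1 x v) * (c * dirichlet_weight alpha a 1 x * y))%:E =
  \int[mu]_u (\1_A u * (c * (kober_kernel alpha a u v * y)))%:E.
Proof.
move=> c0 y0 mA vy.
have [v0|/vy ->] := pselect (positive_orthant v); last first.
  by rewrite !integral0_eq// => x _; rewrite !mulr0.
have cy0 : (0 <= c * y)%R by rewrite mulr_ge0.
have m1A : measurable_fun setT (fun u => (\1_A u)%:E : \bar R).
  exact/measurable_EFinP.
have mst : measurable_fun setT (fun x : k.-tuple R => (\1_A (stick_map 1 x v) : R)%:E).
  by apply: (measurableT_comp m1A); exact: measurable_stick_map.
have mw : measurable_fun setT (fun x : k.-tuple R =>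
    (dirichlet_weight alpha a 1 x)%:E * (\1_A (stick_map 1 x v))%:E).
  apply: emeasurable_funM => //; apply/measurable_EFinP.
  exact: measurable_dirichlet_weight.
have mk : measurable_fun setT (fun u => (kober_kernel alpha a u v)%:E * (\1_A u)%:E).
  apply: emeasurable_funM => //; apply/measurable_EFinP.
  exact: measurable_kober_kernel.
transitivity (\int[mu]_x ((c * y)%:E *
    ((dirichlet_weight alpha a 1 x)%:E * (\1_A (stick_map 1 x v))%:E))).
  by apply: eq_integral => x _; rewrite -!EFinM; congr (_%:E); ring.
transitivity (\int[mu]_u ((c * y)%:E *
    ((kober_kernel alpha a u v)%:E * (\1_A u)%:E))); last first.
  by apply: eq_integral => u _; rewrite -!EFinM; congr (_%:E); ring.
have w0 x : 0 <= (dirichlet_weight alpha a 1 x)%:E * (\1_A (stick_map 1 x v))%:E.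
  by rewrite -EFinM lee_fin mulr_ge0// dirichlet_weight_ge0.
have k0 u : 0 <= (kober_kernel alpha a u v)%:E * (\1_A u)%:E.
  by rewrite -EFinM lee_fin mulr_ge0// kober_kernel_ge0.
rewrite !ge0_integralZl// -!muE//.
rewrite (lebint_stick_map alpha a (Phi := fun u => (\1_A u)%:E) ltr01 v0)//.
by rewrite powR1 mul1e.
Qed.

Lemma measurable_kober_density (c : R) (f : k.-tuple R -> R) :
  measurable_fun setT f ->
  measurable_fun setT (fun z : k.-tuple R * k.-tuple R =>
    (c * (kober_kernel alpha a z.1 z.2 * f z.2))%R).
Proof.
move=> mf; apply: measurable_funM => //; apply: measurable_funM.
  exact: measurable_kober_kernel.
exact: measurableT_comp.
Qed.

(** After the change of variables for each [v], Tonelli's theorem brings the integral over [u]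
    outside. *)
Lemma integral_kober_density (c : R) (f : k.-tuple R -> R) A : (0 <= c)%R ->
  measurable_fun setT f -> (forall v, 0 <= f v)%R ->
  (forall v, ~ positive_orthant v -> f v = 0%R) -> measurable A ->
  \int[mu]_v \int[mu]_x
    (\1_A (stick_map 1 x v) * (c * dirichlet_weight alpha a 1 x * f v))%:E =
  \int[mu]_(u in A) \int[mu]_v (c * (kober_kernel alpha a u v * f v))%:E.
Proof.
move=> c0 mf f0 fpos mA.
under eq_integral => v _ do rewrite (integral_stick_map c0 (f0 v) mA (fpos v)).
pose F (z : k.-tuple R * k.-tuple R) : \bar R :=
  (\1_A z.1 * (c * (kober_kernel alpha a z.1 z.2 * f z.2)))%:E.
have G0 u v : (0 <= c * (kober_kernel alpha a u v * f v))%R.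
  by rewrite mulr_ge0// mulr_ge0// kober_kernel_ge0.
have mF : measurable_fun setT F.
  apply/measurable_EFinP; apply: measurable_funM; last exact: measurable_kober_density.
  have m1A : measurable_fun setT (\1_A : k.-tuple R -> R) by exact: measurable_indic.
  exact: (measurableT_comp m1A measurable_fst).
have F0 z : 0 <= F z by rewrite lee_fin mulr_ge0.
transitivity (\int[mu]_v fubini_G mu F v); first by [].
rewrite -(fubini_tonelli _ mF F0).
rewrite [RHS]integral_mkcond; apply: eq_integral => u _.
rewrite patchE /fubini_F /F/= indicE; case: ifPn => _.
  by apply: eq_integral => v _; rewrite mul1r.
by apply: integral0_eq => v _; rewrite mul0r.
Qed.

End kober_density.

Theorem theorem1p2 (R : realType) (k : nat) (alpha : 'I_k -> R) (a : R)
  (d : measure_display) (T : measurableType d) (P : probability T R)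
  (X V : T -> k.-tuple R) (f g : k.-tuple R -> R) :
  (0 < k)%N ->
  (forall j, -1 < alpha j) -> 0 < a ->
  measurable_fun setT X -> measurable_fun setT V ->
  has_density P X (dirichlet1_density alpha a) ->
  measurable_fun setT f -> (forall v, 0 <= f v) ->
  (forall v, ~ @positive_orthant R k v -> f v = 0) ->
  has_density P V f ->
  indep_vec P X V ->
  measurable_fun setT g -> (forall u, 0 <= g u) ->
  has_density P
    (fun w => [tuple tnth (V w) j * (tnth (X w) j / (1 - psum (X w) j)) | j < k]) g ->
  exists N : set (k.-tuple R),
    [/\ measurable N, lebint (fun t => (\1_N t)%:E) = 0%E &
      forall u, @positive_orthant R k u -> ~ N u ->
        ((\prod_(j < k) (Gamma (alpha j + 1) /
                          Gamma (alpha j + beta_param alpha a j + 1))) * g u)%:E =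
        kober2 alpha (beta_param alpha a) f u].
Proof.
move=> k0 alpha1 a0 mX mV dX mf f0 fpos dV XV mg g0 dU.
have [mu muE] := ex_tuple_lebesgue R k.
pose C := dirichlet1_const alpha a.
pose h x := C * dirichlet_weight alpha a 1 x.
have C0 : 0 <= C by exact: dirichlet1_const_ge0.
have h0 x : 0 <= h x by rewrite mulr_ge0// dirichlet_weight_ge0.
have mh : measurable_fun setT h.
  by apply: measurable_funM => //; exact: measurable_dirichlet_weight.
have densE (Y : T -> k.-tuple R) (q : k.-tuple R -> R) :
    measurable_fun setT q -> (forall t, 0 <= q t) ->
    has_density P Y q -> forall A, measurable A ->
    P (Y @^-1` A) = (\int[mu]_t (\1_A t * q t)%:E)%E.
  move=> mq q0 dY A mA; rewrite dY// muE//.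
    by apply/measurable_EFinP; exact: measurable_funM.
  by move=> t; rewrite lee_fin mulr_ge0.
have {}dX : has_density P X h.
  rewrite (_ : h = dirichlet1_density alpha a)//.
  by apply/funext => x; rewrite dirichlet1_densityE.
(* With [C = 0] the density of [X] would vanish and [P] would have total mass 0. *)
have Cneq0 : C != 0.
  apply/eqP => CE; have := densE X h mh h0 dX _ measurableT.
  rewrite preimage_setT probability_setT integral0_eq => [/eqP|x _].
    by rewrite eqe oner_eq0.
  by rewrite /h CE mul0r mulr0.
pose G u := (\int[mu]_v (C * (kober_kernel alpha a u v * f v))%:E)%E.
have K0 u v : 0 <= kober_kernel alpha a u v * f v.
  by rewrite mulr_ge0// kober_kernel_ge0.
have mG : measurable_fun setT G.
  apply: (measurable_fun_fubini_tonelli_F (m2 := mu)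
    (fun z => (C * (kober_kernel alpha a z.1 z.2 * f z.2))%:E)).
    by apply/measurable_EFinP; exact: measurable_kober_density.
  by move=> z; rewrite lee_fin mulr_ge0.
pose U w := stick_map 1 (X w) (V w).
(* Integrating the joint density of [X] and [V] over the preimage of [A] shows that [G] is a density
   of [U]. *)
have PU A : measurable A -> P (U @^-1` A) = (\int[mu]_(u in A) G u)%E.
  move=> mA; rewrite -(integral_kober_density alpha a muE C0 mf f0 fpos mA).
  have mB : measurable [set z : k.-tuple R * k.-tuple R | A (stick_map 1 z.1 z.2)].
    have mst : measurable_fun setT
        (fun z : k.-tuple R * k.-tuple R => stick_map 1 z.1 z.2).
      exact: measurable_stick_map.
    by rewrite -[X in measurable X]setTI; exact: mst.
  exact: (indep_joint_density mX mV mh h0 mf f0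
    (densE X h mh h0 dX) (densE V f mf f0 dV) XV mB).
have gA A : measurable A -> P (U @^-1` A) = (\int[mu]_(u in A) (g u)%:E)%E.
  move=> mA; rewrite (densE U g mg g0 dU A mA).
  rewrite [RHS]integral_mkcond; apply: eq_integral => u _.
  by rewrite patchE indicE; case: ifPn => _; rewrite ?mul1r ?mul0r.
have : ae_eq mu setT (EFin \o g) G.
  (* Equal integrals over all measurable sets force equality almost everywhere once [g] is
     integrable; its integral is the total probability. *)
  apply: integral_ae_eq => // [|A _ mA]; last by rewrite -PU// gA.
  apply/integrableP; split; first exact/measurable_EFinP.
  under eq_integral => u _ do rewrite /= ger0_norm//.
  by rewrite -gA// preimage_setT probability_setT ltry.
(* [N] is a measurable null set containing the points where [g] and [G] differ. *)
case=> N [mN N0 subN]; exists N; split => //.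
  by rewrite muE ?integral_indic ?setIT//; exact/measurable_EFinP.
move=> u u0 Nu.
have gG : (g u)%:E = G u by apply: contra_notP Nu => H; apply: subN => /= /(_ I).
have mK : measurable_fun setT (fun v => (kober_kernel alpha a u v * f v)%:E).
  apply/measurable_EFinP; apply: measurable_funM => //.
  exact: measurable_kober_kernel.
(* Only constants remain: the Gamma quotients times [C] collapse to the normalising factors of
   [kober2]. *)
rewrite EFinM gG /G kober2E// -(dirichlet1_const_beta alpha1 Cneq0).
under eq_integral => v _ do rewrite EFinM.
have KE0 v : (0 <= (kober_kernel alpha a u v * f v)%:E)%E by rewrite lee_fin.
by rewrite ge0_integralZl// (muE _ mK)// EFinM muleA.
Qed.
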